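(* Let $K\in\mathbb{R}$, $K_s>0$, $m\in[0,1]$, and let $\theta:[0,1]\to\mathbb{T}$ be defined (almost everywhere) by $\theta(x)=0$ if $x\in[0,m)$ and $\theta(x)=\pi$ if $x\in(m,1]$. Consider the energy $$E(\theta)=\frac K2\int_0^1\!\!\int_0^1\cos(\theta(x)-\theta(y))\,\mathrm{d}x\,\mathrm{d}y-\frac{K_s}{2}\int_0^1\cos(2\theta(x))\,\mathrm{d}x.$$ Then the following conditions are necessary for $\theta$ to be a directional local minimum of $E$: (i) if $m\in\{0,1\}$: $K/K_s\le 2$; (ii) if $m=1/2$: $-2\le K/K_s$; (iii) if $m\notin\{0,1/2,1\}$: $-2\le K/K_s\le 2/|2m-1|$. Moreover, in each case, the same bounds with the inequalities strict are sufficient for $\theta$ to be a directional local minimum of $E$.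
   Context: $\mathbb{T}=\mathbb{R}/2\pi\mathbb{Z}$. $\Theta$ is the set of measurable functions $\theta:[0,1]\to\mathbb{T}$, identified when equal almost everywhere. For $\theta\in\Theta$ and $p\in L^2([0,1];\mathbb{R})$, $\theta+p\in\Theta$ is defined pointwise modulo $2\pi$. A point $\theta\in\Theta$ is a directional local minimum of $E$ if for every $p\in L^2([0,1];\mathbb{R})$ there exists $\varepsilon_p>0$ such that $E(\theta+hp)\ge E(\theta)$ for all $|h|<\varepsilon_p$. *)

(* Defs.v *)
From HB Require Import structures.
From mathcomp Require Import all_boot all_order all_algebra.
From mathcomp Require Import all_classical all_reals all_analysis.
From mathcomp Require Import measurable_realfun.

Set Implicit Arguments.
Unset Strict Implicit.
Unset Printing Implicit Defensive.
Import Order.TTheory GRing.Theory Num.Theory.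
Import numFieldNormedType.Exports.
Local Open Scope classical_set_scope.
Local Open Scope ring_scope.
Local Open Scope quotient_scope.

Definition twopiZ (R : realType) : {pred R} :=
  fun x => `[< exists k : int, x = (pi *+ 2) *~ k >].

Fact twopiZ_zmod_closed (R : realType) : zmod_closed (@twopiZ R).
Proof.
split=> [|x y /asboolP[j ->] /asboolP[k ->]]; apply/asboolP.
  by exists 0; rewrite mulr0z.
by exists (j - k); rewrite mulrzBr.
Qed.

HB.instance Definition _ (R : realType) :=
  GRing.isZmodClosed.Build R (@twopiZ R) (@twopiZ_zmod_closed R).

Definition circle (R : realType) : Type := {ideal_quot (@twopiZ R)}.

HB.instance Definition _ (R : realType) := GRing.Zmodule.on (circle R).
HB.instance Definition _ (R : realType) :=
  @EqQuotient.on (circle R).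
HB.instance Definition _ (R : realType) := isPointed.Build (circle R) 0.

Definition angle (R : realType) (x : R) : circle R := \pi_(circle R) x.

(* The quotient sigma-algebra; it coincides with the Borel sigma-algebra of
   the quotient topology. *)
Definition circle_measurable (R : realType) : set (set (circle R)) :=
  [set A | measurable (@angle R @^-1` A)].

Section circle_measurable.
Variable R : realType.

Let circle_measurable0 : circle_measurable (set0 : set (circle R)).
Proof. by rewrite /circle_measurable /= preimage_set0. Qed.

Let circle_measurableC (A : set (circle R)) :
  circle_measurable A -> circle_measurable (~` A).
Proof.
by rewrite /circle_measurable /= preimage_setC; exact: measurableC.
Qed.

Let circle_measurable_bigcup (F : (set (circle R))^nat) :
  (forall i, circle_measurable (F i)) -> circle_measurable (\bigcup_i F i).
Proof.
move=> mF; rewrite /circle_measurable /= preimage_bigcup.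
exact: bigcupT_measurable.
Qed.

HB.instance Definition _ := @isMeasurable.Build default_measure_display
  (circle R) (@circle_measurable R)
  circle_measurable0 circle_measurableC circle_measurable_bigcup.

End circle_measurable.

Section circle_theory.
Variable R : realType.
Implicit Types (x y : R) (t : circle R).

Lemma measurable_angle : measurable_fun [set: measurableTypeR R] (@angle R).
Proof. by move=> _ A mA; rewrite setTI. Qed.

Lemma reprcK t : angle (repr t) = t.
Proof. exact: reprK. Qed.

Lemma angleD x y : angle (x + y) = angle x + angle y.
Proof. exact: (raddfD \pi_(circle R)). Qed.

Lemma angle_eq x y :
  angle x = angle y <-> exists k : int, x = y + (pi *+ 2) *~ k.
Proof.
have e : (angle x == angle y) = twopiZ (x - y).
  by rewrite /angle eqmodE.
split=> [/eqP|[k xy]].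
  by rewrite e => /asboolP[k xyk]; exists k; rewrite -xyk addrC subrK.
by apply/eqP; rewrite e; apply/asboolP; exists k; rewrite xy addrAC subrr add0r.
Qed.

End circle_theory.

Definition cosT (R : realType) (t : circle R) : R := cos (repr t).

Lemma cosT_angle (R : realType) (x : R) : cosT (angle x) = cos x.
Proof.
have cosz (y : R) (k : int) : cos (y + (pi *+ 2) *~ k) = cos y.
  have cosn (z : R) (n : nat) : cos (z + pi *+ 2 *+ n) = cos z.
    elim: n => [|n IH]; first by rewrite mulr0n addr0.
    by rewrite mulrSr addrA cosD2pi.
  case: k => n; first exact: cosn.
  by rewrite NegzE mulrNz -(cosn (_ - _) n.+1) subrK.
have /angle_eq[k xk] := reprcK (angle x).
by rewrite /cosT xk cosz.
Qed.

(* A measurable section of [angle], with values in [0, 2 pi[; the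
   representatives picked by [repr] need not depend measurably on t. *)
Definition lift_angle (R : realType) (t : circle R) : R :=
  repr t - pi *+ 2 *~ Num.floor (repr t / (pi *+ 2)).

Lemma lift_angleK (R : realType) : cancel (@lift_angle R) (@angle R).
Proof.
move=> t; rewrite -[RHS]reprcK; apply/angle_eq.
by exists (- Num.floor (repr t / (pi *+ 2))); rewrite mulrNz.
Qed.

Lemma lift_angleE (R : realType) (x : R) :
  lift_angle (angle x) = x - pi *+ 2 *~ Num.floor (x / (pi *+ 2)).
Proof.
rewrite /lift_angle; have /angle_eq[k ->] := reprcK (angle x).
have tpi0 : (pi *+ 2 : R) != 0 by rewrite mulrn_eq0/= gt_eqF// pi_gt0.
have -> : (x + pi *+ 2 *~ k) / (pi *+ 2) = x / (pi *+ 2) + k%:~R.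
  by rewrite mulrDl -mulrzr mulrAC divff// mul1r.
rewrite floorDrz ?intr_int// intrKfloor mulrzDr opprD.
by rewrite [X in _ + X]addrC addrA addrK.
Qed.

Lemma measurable_lift_angle (R : realType) :
  measurable_fun [set: circle R] (@lift_angle R : circle R -> measurableTypeR R).
Proof.
move=> _ B mB; rewrite setTI.
rewrite /measurable/= /circle_measurable /= -comp_preimage.
have -> : @lift_angle R \o @angle R =
    (fun x => x - (pi *+ 2) * (Num.floor (x / (pi *+ 2)))%:~R).
  by apply/funext => x /=; rewrite lift_angleE mulrzr.
rewrite -[X in measurable X]setTI.
have mf : measurable_fun [set: R]
    (fun x : R => x - (pi *+ 2) * (Num.floor (x / (pi *+ 2)))%:~R : R).
  apply: measurable_funD => //; apply: measurableT_comp => //.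
  apply: measurable_funM => //.
  apply: nondecreasing_measurable => // x y xy.
  rewrite ler_int le_floor//.
  by rewrite ler_wpM2r// invr_ge0 mulrn_wge0// pi_ge0.
exact: mf.
Qed.

Fact measurable01 (R : realType) :
  @measurable _ (measurableTypeR R) `[0%R, 1%R]%classic.
Proof. exact: (@measurable_itv R). Qed.

Fact lebesgue01_lty (R : realType) :
  (@lebesgue_measure R `[0%R, 1%R]%classic < +oo)%E.
Proof. by rewrite lebesgue_measure_itv/= lte01 oppr0 adde0 ltry. Qed.

(* Lebesgue measure restricted to [0, 1]. *)
Definition mu01 (R : realType) : set (measurableTypeR R) -> \bar R :=
  mfrestr (@measurable01 R) (lebesgue01_lty R).

HB.instance Definition _ (R : realType) := FiniteMeasure.on (@mu01 R).

(* Functions are defined on the whole line but identified when they are equal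
   mu01-almost everywhere, so that only their values on [0, 1] matter. *)
Definition Theta (R : realType) : Type :=
  {mfun_ (@mu01 R), measurableTypeR R >-> circle R}.

HB.instance Definition _ (R : realType) := EqQuotient.on (Theta R).

Definition Theta_fun (R : realType) (theta : Theta R) :
  measurableTypeR R -> circle R := aqEqMfun_to_fun theta.
Coercion Theta_fun : Theta >-> Funclass.

(* Square-integrable functions, as representatives of elements of L^2: since
   Theta identifies a.e. equal functions, translates only depend on the class. *)
Notation L2 R := (LfunType (@mu01 R) (lee1n 2)).

Section translate.
Variables (R : realType) (theta : Theta R) (p : L2 R).

Definition translate_fun (x : measurableTypeR R) : circle R :=
  theta x + angle (p x).

Let measurable_translate_fun :
  measurable_fun [set: measurableTypeR R] translate_fun.
Proof.
have -> : translate_fun =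
    @angle R \o (fun x : measurableTypeR R => lift_angle (theta x) + p x : R).
  by apply/funext => x; rewrite /translate_fun /= angleD lift_angleK.
apply: (measurableT_comp (@measurable_angle R)).
apply: (@measurable_funD _ (measurableTypeR R) R); last exact: measurable_funPT.
apply: (measurableT_comp (@measurable_lift_angle R)).
exact: (@measurable_funPT _ _ _ _ (repr theta)).
Qed.

HB.instance Definition _ := isMeasurableFun.Build _ _ (measurableTypeR R)
  (circle R) translate_fun measurable_translate_fun.

Definition translate : Theta R :=
  \pi_(Theta R) (translate_fun : {mfun measurableTypeR R >-> circle R}).

Lemma translateE : {ae @mu01 R, forall x, translate x = theta x + angle (p x)}.
Proof.
have /eqP := reprK translate; rewrite {2}/translate eqmodE => /asboolP.
by apply: filterS => x /(_ I).
Qed.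

End translate.

Definition energy (R : realType) (K Ks : R) (theta : Theta R) : R :=
  K / 2 * (\int[@mu01 R]_x \int[@mu01 R]_y cosT (theta x - theta y))
  - Ks / 2 * \int[@mu01 R]_x cosT (theta x *+ 2).

Definition directional_local_min (R : realType) (E : Theta R -> R)
    (theta : Theta R) : Prop :=
  forall p : L2 R, exists2 eps : R, 0 < eps &
    forall h : R, `|h| < eps -> E theta <= E (translate theta (h *: p)).

(* Main.v *)
Require Import Defs.
From mathcomp Require Import all_boot all_order all_algebra.
From mathcomp Require Import all_classical all_reals all_analysis.
From mathcomp Require Import measurable_realfun ring lra.

Set Implicit Arguments.
Unset Strict Implicit.
Unset Printing Implicit Defensive.
Import Order.TTheory GRing.Theory Num.Theory.
Import numFieldNormedType.Exports.
Local Open Scope classical_set_scope.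
Local Open Scope ring_scope.

(* Write [s = cos theta] (so [s = 1] on [0, m[ and [s = -1] on ]m, 1]) and
   [M = 2 m - 1] for the integral of [s]. By dominated convergence, the energy
   increment along [h p], divided by [h ^ 2], tends to
     [Ks int p^2 + K / 2 ((int s p)^2 - M int s p^2)].
   A local minimum makes this quadratic form nonnegative; testing it on step
   functions gives the necessary conditions. Conversely, if the form is positive
   at every [p] not a.e. zero, [theta] is a directional local minimum. With [P], [N]
   ([X], [Y]) the integrals of [p^2] ([p]) on both sides of [m],
   Cauchy-Schwarz gives [X^2 <= m P] and [Y^2 <= (1 - m) N], and for [K < 0] the
   bound [(X - Y)^2 <= 2 X^2 + 2 Y^2] makes the form at least
   [(Ks + K / 2) (P + N)]. *)

(** * Elementary bounds and limits for sine and cosine *)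

Lemma normr_sin_le (R : realType) (x : R) : `|sin x| <= `|x|.
Proof.
wlog x0 : x / 0 <= x => [H|].
  have [/H//|/ltW x0] := leP 0 x.
  by rewrite -(normrN (sin x)) -(normrN x) -sinN H// oppr_ge0.
have [c _] := @MVT_segment R sin cos 0 x x0 (fun y _ => is_derive_sin y)
  (continuous_subspaceT (@continuous_sin R)).
rewrite sin0 !subr0 => ->; rewrite normrM ler_piMl//.
exact: cos_max.
Qed.

(** The half-angle form reduces the limit of [1 - cos] over [u ^ 2] to that of [sin] over [u]. *)
Lemma one_sub_cos (R : realType) (x : R) : 1 - cos x = 2 * sin (x / 2) ^+ 2.
Proof.
rewrite {1}(_ : x = (x / 2) *+ 2) ?cos_mulr2n ?cos2sin2; last by rewrite mulr2n; lra.
by rewrite mulr2n; lra.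
Qed.

(** The quotient is the difference quotient at [0] of [h |-> sin (h * a)], whose derivative there is
    [a]; nonvanishing of [u] puts it in the punctured neighbourhood filter. *)
Lemma cvg_sin_div (R : realType) (u : R^nat) (a : R) :
  u @ \oo --> 0 -> (forall n, u n != 0) ->
  sin (u n * a) / u n @[n --> \oo] --> a.
Proof.
move=> u0 un0.
have [dsin dsinE] : is_derive (0 : R) 1 (fun h => sin (h * a)) a.
  apply: is_derive_eq; rewrite mul0r cos0.
  by rewrite /GRing.scale /=; ring.
have u0' : u @ \oo --> 0^'.
  move=> A /= A0; have /u0 : nbhs (0 : R) [set x | x != 0 -> A x] by exact: A0.
  by rewrite !nbhs_filterE /= /fmap /=; apply: filterS => n /=; exact.
have := cvg_comp _ _ u0' dsin.
rewrite -/(derive _ _ _) dsinE.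
apply: cvg_trans; apply: near_eq_cvg; apply: nearW => n /=.
rewrite mul0r sin0 subr0 addr0 /GRing.scale /= mulr1.
by rewrite mulrC.
Qed.

(** * Dominated convergence for real-valued integrals *)

Section Rintegral_dominated_cvg.
Context d (T : measurableType d) (R : realType) (mu : {measure set T -> \bar R}).

Lemma integrable_domin (f g : T -> R) : measurable_fun setT f ->
  (forall x, `|f x| <= g x) -> mu.-integrable setT (EFin \o g) ->
  mu.-integrable setT (EFin \o f).
Proof.
move=> mf fg; apply: le_integrable => //; first exact/measurable_EFinP.
by move=> x _ /=; rewrite lee_fin (le_trans (fg x))// ler_norm.
Qed.

Lemma Rintegral_dominated_cvg (f_ : (T -> R)^nat) (f g : T -> R) :
  (forall n, measurable_fun setT (f_ n)) ->
  (forall x, f_ n x @[n --> \oo] --> f x) ->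
  mu.-integrable setT (EFin \o g) ->
  (forall n x, `|f_ n x| <= g x) ->
  \int[mu]_x f_ n x @[n --> \oo] --> \int[mu]_x f x.
Proof.
move=> mf_ f_f ig fg.
have mf : measurable_fun setT f.
  by apply: (@measurable_fun_cvg _ _ _ _ f_) => // x _; exact: f_f.
have fg' x : `|f x| <= g x.
  have fx : `|f_ n x| @[n --> \oo] --> `|f x| by apply: cvg_norm; exact: f_f.
  by apply: (ler_cvg_to fx (cvg_cst (g x))); apply: nearW => n; exact: fg.
apply: fine_cvg; rewrite fineK; last first.
  by apply: integrable_fin_num => //; exact: integrable_domin ig.
apply: (@dominated_cvg _ _ _ mu setT _ (fun n x => (f_ n x)%:E)
  (EFin \o f) (EFin \o g)) => //.
- by move=> n; exact/measurable_EFinP.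
- by move=> x _; apply: cvg_EFin; [exact: nearW|exact: f_f].
- by move=> n x _ /=; rewrite lee_fin.
Qed.

End Rintegral_dominated_cvg.

(** * Second-order expansion of the energy gap *)

Section second_order.
Context d (T : measurableType d) (R : realType).
Variable mu : {finite_measure set T -> \bar R}.

Lemma integrable_le_cst (f : T -> R) (C : R) : measurable_fun setT f ->
  (forall x, `|f x| <= C) -> mu.-integrable setT (EFin \o f).
Proof.
move=> mf fC; apply: (integrable_domin mf (g := cst C) fC).
exact: finite_measure_integrable_cst.
Qed.

Lemma ae_eq_Rintegral (f g : T -> R) :
  measurable_fun setT f -> measurable_fun setT g ->
  {ae mu, forall x, f x = g x} -> \int[mu]_x f x = \int[mu]_x g x.
Proof.
move=> mf mg fg; congr fine; apply: ae_eq_integral => //.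
- exact/measurable_EFinP.
- exact/measurable_EFinP.
- by apply: filterS fg => x /= -> _.
Qed.

Variables (s p : T -> R) (K Ks : R).
Hypotheses (ms : measurable_fun setT s) (s1 : forall x, `|s x| <= 1).
Hypotheses (mp : measurable_fun setT p).
Hypotheses (ip : mu.-integrable setT (EFin \o (fun x => p x ^+ 2))).

(* [gap h] is the value of the energy at [theta + h p] minus its value at
   [theta], for [theta] with values in [{0, pi}] and [s = cos theta]. *)
Definition gap (h : R) : R :=
  K / 2 * ((\int[mu]_x (s x * cos (h * p x))) ^+ 2 +
           (\int[mu]_x (s x * sin (h * p x))) ^+ 2 - (\int[mu]_x s x) ^+ 2)
  + Ks * \int[mu]_x (sin (h * p x) ^+ 2).

(** Coefficient of [h ^ 2] in the expansion of [gap h] at [0]. *)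
Definition hess : R :=
  Ks * (\int[mu]_x (p x ^+ 2)) +
  K / 2 * ((\int[mu]_x (s x * p x)) ^+ 2
           - (\int[mu]_x s x) * \int[mu]_x (s x * p x ^+ 2)).

Let msin (h : R) : measurable_fun setT (fun x => sin (h * p x)).
Proof.
apply: measurableT_comp; first exact: (continuous_measurable_fun (@continuous_sin R)).
exact: measurable_funM.
Qed.

Let mcos (h : R) : measurable_fun setT (fun x => cos (h * p x)).
Proof.
apply: measurableT_comp; first exact: (continuous_measurable_fun (@continuous_cos R)).
exact: measurable_funM.
Qed.

(** The measure is finite, so constants are integrable, and [|p| <= 1 + p ^ 2] follows from
    [(|p| - 1) ^ 2 >= 0]. *)
Lemma integrable_sq_integrable : mu.-integrable setT (EFin \o p).
Proof.
have i1 : mu.-integrable setT (EFin \o (cst 1 : T -> R)).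
  exact: finite_measure_integrable_cst.
apply: (integrable_domin (g := fun x => 1 + p x ^+ 2)) => //.
  move=> x; have := sqr_ge0 (`|p x| - 1).
  have := normr_ge0 (p x).
  by rewrite sqrrB real_normK ?num_real//; nra.
exact: (integrableD _ i1 ip).
Qed.

Section cvg.
Variable u : R^nat.
Hypotheses (u0 : u @ \oo --> 0) (un0 : forall n, u n != 0).

(** This bound, uniform in [r], supplies the dominating functions [|p|] and [p ^ 2] for the limits
    below. *)
Let sinu (r a : R) : r != 0 -> `|sin (r * a) / r| <= `|a|.
Proof.
move=> r0; rewrite normrM normfV ler_pdivrMr ?normr_gt0//.
by rewrite -normrM [X in _ <= `|X|]mulrC normr_sin_le.
Qed.

Lemma cvg_int_sin : (\int[mu]_x (s x * sin (u n * p x))) / u n @[n --> \oo] -->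
  \int[mu]_x (s x * p x).
Proof.
rewrite (_ : (fun n => _) =
    fun n => \int[mu]_x (s x * (sin (u n * p x) / u n))); last first.
  apply/funext => n; rewrite -RintegralZr//; last first.
    apply: (integrable_le_cst (C := 1)); first exact: measurable_funM.
    by move=> x; rewrite normrM mulr_ile1 ?sin_max.
  by apply: eq_Rintegral => x _; rewrite mulrA.
apply: (Rintegral_dominated_cvg (g := fun x => `|p x|)).
- by move=> n; do 2?apply: measurable_funM.
- by move=> x; apply: cvgM; [exact: cvg_cst|exact: cvg_sin_div].
- exact: (integrable_norm integrable_sq_integrable).
- by move=> n x; rewrite normrM -[leRHS]mul1r ler_pM// sinu.
Qed.

Lemma cvg_int_sin2 : (\int[mu]_x (sin (u n * p x) ^+ 2)) / u n ^+ 2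
  @[n --> \oo] --> \int[mu]_x (p x ^+ 2).
Proof.
rewrite (_ : (fun n => _) =
    fun n => \int[mu]_x ((sin (u n * p x) / u n) ^+ 2)); last first.
  apply/funext => n; rewrite -RintegralZr//; last first.
    apply: (integrable_le_cst (C := 1)); first exact: measurable_funX.
    by move=> x; rewrite normrX exprn_ile1// sin_max.
  by apply: eq_Rintegral => x _; rewrite expr_div_n.
apply: (Rintegral_dominated_cvg (g := fun x => p x ^+ 2)) => //.
- by move=> n; apply: measurable_funX; apply: measurable_funM.
- by move=> x; apply: cvgM; exact: cvg_sin_div.
- move=> n x; rewrite normrX -[leRHS]real_normK ?num_real//.
  by rewrite lerXn2r ?nnegrE// sinu.
Qed.

(** By the half-angle formula, [(1 - cos (u n * p x)) / u n ^ 2] is half the square of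
    [sin (u n / 2 * p x) / (u n / 2)], so the sine limit along [u / 2] suffices. *)
Lemma cvg_int_1subcos : (\int[mu]_x (s x * (1 - cos (u n * p x)))) / u n ^+ 2
  @[n --> \oo] --> (\int[mu]_x (s x * p x ^+ 2)) / 2.
Proof.
have un2 n : u n / 2 != 0 by rewrite mulf_neq0// invr_eq0 pnatr_eq0.
have u2 : u n / 2 @[n --> \oo] --> 0.
  by rewrite -[X in _ --> X](mul0r 2^-1); apply: cvgM => //; exact: cvg_cst.
rewrite (_ : (fun n => _) = fun n => (\int[mu]_x
    (s x * (sin (u n / 2 * p x) / (u n / 2)) ^+ 2)) / 2); last first.
  apply/funext => n; rewrite -!RintegralZr//; last 2 first.
  - apply: (integrable_domin (g := fun x => p x ^+ 2)) => //.
      apply: measurable_funM => //; apply: measurable_funX.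
      exact: measurable_funM.
    move=> x; rewrite normrM -[leRHS]mul1r ler_pM// normrX.
    by rewrite -[leRHS]real_normK ?num_real// lerXn2r ?nnegrE// sinu.
  - apply: (integrable_le_cst (C := 2)).
      by apply: measurable_funM => //; apply: measurable_funB.
    move=> x; rewrite normrM -[leRHS]mul1r ler_pM//.
    rewrite (le_trans (ler_normB _ _))// normr1 -[leRHS]/(1 + 1) lerD2l.
    exact: cos_max.
  apply: eq_Rintegral => x _; rewrite one_sub_cos.
  rewrite (_ : u n * p x / 2 = u n / 2 * p x); last by ring.
  by field; exact: un0.
apply: cvgM; last exact: cvg_cst.
apply: (Rintegral_dominated_cvg (g := fun x => p x ^+ 2)) => //.
- move=> n; apply: measurable_funM => //; apply: measurable_funX.
  exact: measurable_funM.
- by move=> x; apply: cvgM; [exact: cvg_cst|apply: cvgM; exact: cvg_sin_div].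
- move=> n x; rewrite normrM -[leRHS]mul1r ler_pM// normrX.
  by rewrite -[leRHS]real_normK ?num_real// lerXn2r ?nnegrE// sinu.
Qed.

Lemma cvg_gap : gap (u n) / u n ^+ 2 @[n --> \oo] --> hess.
Proof.
pose a n := \int[mu]_x (s x * (1 - cos (u n * p x))).
have is_ : mu.-integrable setT (EFin \o s).
  exact: (integrable_le_cst (C := 1)).
have cosE n : \int[mu]_x (s x * cos (u n * p x)) = \int[mu]_x s x - a n.
  rewrite /a -RintegralB//.
    by apply: eq_Rintegral => x _; ring.
  apply: (integrable_le_cst (C := 2)).
    by apply: measurable_funM => //; apply: measurable_funB.
  move=> x; rewrite normrM -[leRHS]mul1r ler_pM//.
  rewrite (le_trans (ler_normB _ _))// normr1 -[leRHS]/(1 + 1) lerD2l.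
  exact: cos_max.
(* The cosine integral is [\int s - a n], so the difference of squares is
   [a n ^ 2 - 2 (\int s) a n]. The term [a n ^ 2 / u n ^ 2] is split as
   [(a n / u n ^ 2) ^ 2 * u n ^ 2], which tends to zero. *)
rewrite (_ : (fun n => _) =
  fun n => Ks * ((\int[mu]_x (sin (u n * p x) ^+ 2)) / u n ^+ 2)
  + K / 2 * (((\int[mu]_x (s x * sin (u n * p x))) / u n) ^+ 2
     - 2 * (\int[mu]_x s x) * (a n / u n ^+ 2)
     + (a n / u n ^+ 2) ^+ 2 * u n ^+ 2)); last first.
  by apply/funext => n; rewrite /gap cosE; field; exact: un0.
(* The null factor [0 ^+ 2] matches the limit of [u n ^ 2]. *)
rewrite (_ : hess = Ks * (\int[mu]_x (p x ^+ 2)) +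
  K / 2 * ((\int[mu]_x (s x * p x)) ^+ 2
  - 2 * (\int[mu]_x s x) * ((\int[mu]_x (s x * p x ^+ 2)) / 2)
  + ((\int[mu]_x (s x * p x ^+ 2)) / 2) ^+ 2 * 0 ^+ 2)); last first.
  by rewrite /hess; field.
apply: cvgD; apply: cvgM; try exact: cvg_cst; first exact: cvg_int_sin2.
apply: cvgD; last by apply: cvgM; apply: cvgM => //; exact: cvg_int_1subcos.
apply: cvgB; first by apply: cvgM; exact: cvg_int_sin.
by apply: cvgM; [exact: cvg_cst|exact: cvg_int_1subcos].
Qed.

End cvg.

(** [hess] is the limit of [gap h / h ^ 2] along the harmonic sequence, whose terms are eventually
    smaller than [eps]. *)
Lemma hess_ge0 (eps : R) : 0 < eps ->
  (forall h, `|h| < eps -> 0 <= gap h) -> 0 <= hess.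
Proof.
move=> eps0 gap0.
apply: (cvgr_to_ge (cvg_gap cvg_harmonic _)).
  by move=> n; rewrite gt_eqF// harmonic_gt0.
have /cvgrPdist_lt/(_ eps eps0) := @cvg_harmonic R.
apply: filterS => n; rewrite sub0r normrN => hn.
by rewrite mulr_ge0 ?gap0// invr_ge0 sqr_ge0.
Qed.

(** By contradiction: otherwise every [n] has some [h] with [|h| < harmonic n] and [gap h < 0], and
    along these points [gap h / h ^ 2] would tend to [hess > 0] while staying negative. *)
Lemma hess_gt0_gap : 0 < hess ->
  exists2 eps : R, 0 < eps & forall h, `|h| < eps -> 0 <= gap h.
Proof.
move=> hess0; apply: contrapT => noeps.
have /choice[u uP] n : exists h : R, `|h| < harmonic n /\ gap h < 0.
  apply: contrapT => nouh; apply: noeps; exists (harmonic n); first exact: harmonic_gt0.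
  move=> h hn; rewrite leNgt; apply/negP => gh; apply: nouh.
  by exists h.
(* The chosen points, where [gap] is negative, are therefore nonzero. *)
have gap0 : gap 0 = 0.
  rewrite /gap.
  under eq_Rintegral do rewrite mul0r cos0 mulr1.
  under [X in _ + X ^+ 2]eq_Rintegral do rewrite mul0r sin0 mulr0.
  under [X in Ks * X]eq_Rintegral do rewrite mul0r sin0 expr0n/=.
  by rewrite !Rintegral_cst// !mul0r mulr0 expr0n /=; ring.
have un0 n : u n != 0.
  by have [_] := uP n; apply: contraTneq => ->; rewrite gap0 ltxx.
have u0 : u @ \oo --> 0.
  apply/cvgrPdist_lt => e e0.
  have /cvgrPdist_lt/(_ e e0) := @cvg_harmonic R.
  apply: filterS => n; rewrite !sub0r !normrN => hn.
  by apply: lt_trans (uP n).1 _; rewrite (le_lt_trans _ hn)// ler_norm.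
have [N _ /(_ N (leqnn N)) /=] := cvgr_gt _ (cvg_gap u0 un0) _ hess0.
by rewrite pmulr_lgt0 ?invr_gt0 ?exprn_even_gt0//= ltNge ltW// (uP N).2.
Qed.

End second_order.

(** * The energy through a real-valued lift *)

Lemma cos_angle_eq (R : realType) (x y : R) : angle x = angle y -> cos x = cos y.
Proof. by move=> xy; rewrite -!cosT_angle xy. Qed.

Lemma sin_angle_eq (R : realType) (x y : R) : angle x = angle y -> sin x = sin y.
Proof.
by move=> xy; rewrite -!cosBpihalf; apply: cos_angle_eq; rewrite !angleD xy.
Qed.

Section mu01.
Variable R : realType.
Notation mu := (@mu01 R).

Lemma mu01_itv : {ae mu, forall x : measurableTypeR R, 0 <= x <= 1}.
Proof.
exists (~` `[0, 1]%classic); split.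
- by apply: measurableC; exact: measurable01.
- by rewrite /mu01 /mfrestr /mrestr /= setICl measure0.
- by move=> x /=; rewrite in_itv.
Qed.

Lemma mu01_neq (m : R) : {ae mu, forall x : measurableTypeR R, x != m}.
Proof.
exists [set m]; split; first exact: measurable_set1.
  apply/eqP; rewrite -measure_le0 /mu01 /mfrestr /mrestr /=.
  rewrite -(lebesgue_measure_set1 m); apply: le_measure; rewrite ?inE//.
  exact: measurableI.
by move=> x /= /negP/negPn/eqP.
Qed.

Lemma mu01T : mu setT = 1%E.
Proof.
rewrite /mu01 /mfrestr /mrestr /= setTI lebesgue_measure_itv /=.
by rewrite lte_fin ltr01 oppr0 adde0.
Qed.

Lemma Rintegral01_cst (r : R) : \int[mu]_x r = r.
Proof.
by rewrite Rintegral_cst// [X in fine X](_ : _ = 1%E) ?mulr1//; exact: mu01T.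
Qed.

(** Expanding [cos (a - b)] separates the variables and turns the double integral into a sum of two
    squares. *)
Lemma energyE (K Ks : R) (theta : Theta R) (v : R -> R) :
  measurable_fun setT v -> {ae mu, forall x, theta x = angle (v x)} ->
  energy K Ks theta =
    K / 2 * ((\int[mu]_x cos (v x)) ^+ 2 + (\int[mu]_x sin (v x)) ^+ 2)
    - Ks / 2 * \int[mu]_x cos (v x *+ 2).
Proof.
(* [angle (w x) = theta x] holds for every [x], so null sets stay out of the iterated integral; the
   passage between [w] and [v] is made on single integrals. *)
move=> mv thetav; pose w x := lift_angle (theta x).
have mw : measurable_fun [set: R] w.
  apply: (measurableT_comp (@measurable_lift_angle R)).
  exact: (@measurable_funPT _ _ _ _ (repr theta)).
have wv : {ae mu, forall x, angle (w x) = angle (v x)}.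
  by apply: filterS thetav => x /= <-; rewrite /w lift_angleK.
have mcos (f : R -> R) : measurable_fun setT f -> measurable_fun setT (cos \o f).
  move=> mf; apply: measurableT_comp => //.
  exact: (continuous_measurable_fun (@continuous_cos R)).
have msin (f : R -> R) : measurable_fun setT f -> measurable_fun setT (sin \o f).
  move=> mf; apply: measurableT_comp => //.
  exact: (continuous_measurable_fun (@continuous_sin R)).
have icos (f : R -> R) : measurable_fun setT f -> mu.-integrable setT (EFin \o (cos \o f)).
  move=> mf; apply: (@integrable_le_cst _ _ _ mu _ 1); first exact: mcos.
  by move=> x; exact: cos_max.
have isin (f : R -> R) : measurable_fun setT f -> mu.-integrable setT (EFin \o (sin \o f)).
  move=> mf; apply: (@integrable_le_cst _ _ _ mu _ 1); first exact: msin.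
  by move=> x; exact: sin_max.
have m2 (f : R -> R) : measurable_fun setT f -> measurable_fun setT (fun x => f x *+ 2).
  by move=> mf; apply: measurable_funD.
have -> : \int[mu]_x cos (v x) = \int[mu]_x cos (w x).
  apply: ae_eq_Rintegral; [exact: mcos|exact: mcos|].
  by apply: filterS wv => x /cos_angle_eq.
have -> : \int[mu]_x sin (v x) = \int[mu]_x sin (w x).
  apply: ae_eq_Rintegral; [exact: msin|exact: msin|].
  by apply: filterS wv => x /sin_angle_eq.
have -> : \int[mu]_x cos (v x *+ 2) = \int[mu]_x cos (w x *+ 2).
  apply: ae_eq_Rintegral; [exact: (mcos _ (m2 _ mv))|exact: (mcos _ (m2 _ mw))|].
  apply: filterS wv => x /= E; apply: cos_angle_eq.
  by rewrite !mulr2n (angleD (v x)) (angleD (w x)) E.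
rewrite /energy; congr (_ * _ - _ * _).
  under eq_Rintegral => x _.
    under eq_Rintegral => y _.
      rewrite -(lift_angleK (theta x)) -(lift_angleK (theta y)) -/(w x) -/(w y).
      rewrite (_ : _ - _ = angle (w x - w y)); last first.
        by rewrite -[X in X - _](subrK (angle (w y))) ?addrK; apply/eqP;
          rewrite subr_eq -angleD subrK.
      rewrite cosT_angle cosB.
      over.
    rewrite RintegralD//; last 2 first.
    - apply: (@integrable_le_cst _ _ _ mu _ 1).
        by apply: measurable_funM => //; exact: mcos.
      by move=> y; rewrite normrM mulr_ile1// cos_max.
    - apply: (@integrable_le_cst _ _ _ mu _ 1).
        by apply: measurable_funM => //; exact: msin.
      by move=> y; rewrite normrM mulr_ile1// sin_max.
    rewrite RintegralZl//; last exact: icos.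
    rewrite RintegralZl//; last exact: isin.
    over.
  rewrite RintegralD//; last 2 first.
  - apply: (integrableZr _ _ (icos _ mw)) => //.
  - apply: (integrableZr _ _ (isin _ mw)) => //.
  rewrite RintegralZr//; last exact: icos.
  by rewrite RintegralZr//; last exact: isin.
apply: eq_Rintegral => x _.
by rewrite -(lift_angleK (theta x)) mulr2n -angleD cosT_angle mulr2n.
Qed.

End mu01.

(** * The step configuration and its translates *)

Definition step_sign (R : realType) (m x : R) : R := if x < m then 1 else -1.

Definition step_angle (R : realType) (m x : R) : R := if x < m then 0 else pi.

Section step.
Variables (R : realType) (m : R).
Notation mu := (@mu01 R).
Notation s := (step_sign m).

Lemma measurable_step (a b : R) :
  measurable_fun [set: R] (fun x => if x < m then a else b).
Proof.
apply: measurable_fun_ifT => //.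
exact: measurable_fun_ltr.
Qed.

Lemma measurable_step_sign : measurable_fun [set: R] s.
Proof. exact: measurable_step. Qed.

Lemma normr_step_sign (x : R) : `|s x| <= 1.
Proof. by rewrite /step_sign; case: ifP; rewrite ?normrN normr1. Qed.

Lemma step_signM (x : R) : s x * s x = 1.
Proof. by rewrite /step_sign; case: ifP; rewrite ?mulrNN mulr1. Qed.

Lemma cos_step_angleD (x y : R) : cos (step_angle m x + y) = s x * cos y.
Proof.
rewrite /step_angle /step_sign; case: ifP => _; first by rewrite add0r mul1r.
by rewrite addrC cosDpi mulN1r.
Qed.

Lemma sin_step_angleD (x y : R) : sin (step_angle m x + y) = s x * sin y.
Proof.
rewrite /step_angle /step_sign; case: ifP => _; first by rewrite add0r mul1r.
by rewrite addrC sinDpi mulN1r.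
Qed.

Lemma cos_step_angleD2 (x y : R) : cos ((step_angle m x + y) *+ 2) = 1 - 2 * sin y ^+ 2.
Proof.
rewrite cos_mulr2n cos_step_angleD exprMn expr2 step_signM mul1r cos2sin2.
by rewrite mulr2n; ring.
Qed.

Variables (theta : Theta R) (K Ks : R).
Hypothesis theta_step : {ae mu, forall x, theta x = angle (step_angle m x)}.

Lemma L2_sq_integrable (p : L2 R) :
  mu.-integrable setT (EFin \o (fun x => p x ^+ 2)).
Proof. exact/Lfun2_integrable_sqr/LfunP. Qed.

Lemma measurable_L2 (p : L2 R) : measurable_fun [set: R] p.
Proof. exact: (@measurable_funPT _ _ _ _ p). Qed.

(** Stated for any [theta'], so that it serves for translates and, with [h = 0] and [p = 0], for
    [theta] itself. The constant [- Ks / 2] comes from [mu] having mass [1]. *)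
Lemma energy_shift (h : R) (p : R -> R) (theta' : Theta R) :
  measurable_fun setT p ->
  {ae mu, forall x, theta' x = angle (step_angle m x + h * p x)} ->
  energy K Ks theta' =
  K / 2 * ((\int[mu]_x (s x * cos (h * p x))) ^+ 2 +
           (\int[mu]_x (s x * sin (h * p x))) ^+ 2)
  + Ks * (\int[mu]_x (sin (h * p x) ^+ 2)) - Ks / 2.
Proof.
move=> mp; have mhp : measurable_fun setT (fun x => h * p x).
  exact: measurable_funM.
move=> /(energyE K Ks) -> ; last first.
  by apply: measurable_funD => //; exact: measurable_step.
under eq_Rintegral do rewrite cos_step_angleD.
under [X in _ + X ^+ 2]eq_Rintegral do rewrite sin_step_angleD.
under [X in Ks / 2 * X]eq_Rintegral do rewrite cos_step_angleD2.
have msin : measurable_fun setT (fun x => sin (h * p x)).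
  apply: measurableT_comp => //.
  exact: (continuous_measurable_fun (@continuous_sin R)).
have isin2 : mu.-integrable setT (EFin \o (fun x => sin (h * p x) ^+ 2)).
  apply: (@integrable_le_cst _ _ _ mu _ 1); first exact: measurable_funX.
  by move=> x; rewrite normrX exprn_ile1// sin_max.
rewrite RintegralB//; last 2 first.
- exact: finite_measure_integrable_cst.
- apply: (@integrable_le_cst _ _ _ mu _ 2).
    by apply: measurable_funM => //; exact: measurable_funX.
  by move=> x; rewrite normrM normrX normr_nat -[leRHS]mulr1 ler_pM// exprn_ile1// sin_max.
by rewrite RintegralZl// Rintegral01_cst; field.
Qed.

Lemma energy_translate (h : R) (p : L2 R) :
  energy K Ks (translate theta (h *: p)) = energy K Ks theta + gap mu s p K Ks h.
Proof.
rewrite (@energy_shift h p); last 2 first.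
- exact: (measurable_L2 p).
- have := translateE theta (h *: p).
  apply: filterS2 theta_step => x /= thx ->.
  by rewrite thx angleD.
rewrite (@energy_shift 0 (cst 0) theta); last 2 first.
- exact: measurable_cst.
- by apply: filterS theta_step => x /= ->; rewrite mul0r addr0.
under [X in _ = K / 2 * (X ^+ 2 + _) + _ - _ + _]eq_Rintegral do rewrite mul0r cos0 mulr1.
under [X in _ = K / 2 * (_ + X ^+ 2) + _ - _ + _]eq_Rintegral do rewrite mul0r sin0 mulr0.
under [X in _ = _ + Ks * X - _ + _]eq_Rintegral do rewrite mul0r sin0 expr0n/=.
by rewrite !Rintegral01_cst /gap; ring.
Qed.

Lemma directional_local_min_hess_ge0 (p : L2 R) :
  directional_local_min (energy K Ks) theta -> 0 <= hess mu s p K Ks.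
Proof.
move=> /(_ p)[eps eps0 gap0].
have := @hess_ge0 _ _ _ mu s p K Ks measurable_step_sign normr_step_sign
  (measurable_L2 p) (L2_sq_integrable p) eps eps0.
apply.
by move=> h /gap0; rewrite energy_translate lerDl.
Qed.

Lemma hess_gt0_directional_local_min :
  (forall p : L2 R, \int[mu]_x (p x ^+ 2) != 0 -> 0 < hess mu s p K Ks) ->
  directional_local_min (energy K Ks) theta.
Proof.
move=> hess0 p; have [p0|/hess0 hp] := eqVneq (\int[mu]_x (p x ^+ 2)) 0.
  (* For [p] a.e. zero the translates coincide with [theta], so any radius works. *)
  exists 1 => // h _.
  have pae : {ae mu, forall x, p x = 0}.
    have : (\int[mu]_x `|(p x ^+ 2)%:E| = 0)%E.
      under eq_integral do rewrite gee0_abs ?lee_fin ?sqr_ge0//.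
      rewrite -[LHS]fineK; first by congr EFin.
      exact: (integrable_fin_num measurableT (L2_sq_integrable p)).
    move/ae_eq_integral_abs => /(_ measurableT) H.
    have : ae_eq mu setT (fun x => (p x ^+ 2)%:E) (cst 0%E).
      apply: H; apply/measurable_EFinP; apply: measurable_funX.
      exact: (measurable_L2 p).
    apply: filterS => x /(_ I) /= [/eqP].
    by rewrite sqrf_eq0 => /eqP.
  rewrite (@energy_shift 0 (cst 0) theta); last 2 first.
  - exact: measurable_cst.
  - by apply: filterS theta_step => x /= ->; rewrite mul0r addr0.
  (* The translate is also described by the zero shift, so both energies have the same
     expression. *)
  rewrite (@energy_shift 0 (cst 0) (translate _ _))//.
  have := translateE theta (h *: p).
  apply: filterS3 theta_step pae => x /= thx px ->.
  rewrite thx -angleD; congr (angle (_ + _)).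
  have -> : 0 * 0 = h * p x by rewrite px !mulr0.
  by [].
have [eps eps0 gap0] := @hess_gt0_gap _ _ _ mu s p K Ks measurable_step_sign normr_step_sign
  (measurable_L2 p) (L2_sq_integrable p) hp.
by exists eps => // h /gap0; rewrite energy_translate lerDl.
Qed.

End step.

(** * A weighted Cauchy-Schwarz inequality *)

Lemma discriminant_le0 (R : realFieldType) (a b c : R) : 0 <= a ->
  (forall t, 0 <= c - 2 * t * b + t ^+ 2 * a) -> b ^+ 2 <= a * c.
Proof.
rewrite le_eqVlt => /predU1P[<- H|a0 H].
  have [->|b0] := eqVneq b 0; first by rewrite expr0n mul0r.
  (* With [a = 0] the polynomial is affine in [t] and equals [-1] at this point. *)
  have := H ((c + 1) / (2 * b)).
  rewrite (_ : _ + _ = -1); first by rewrite ler0N1.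
  by field.
(* [b / a] minimises the quadratic polynomial. *)
have := H (b / a).
rewrite (_ : _ + _ = (a * c - b ^+ 2) / a); last by field; rewrite gt_eqF.
by rewrite pmulr_lge0 ?invr_gt0// subr_ge0.
Qed.

Section weighted_Cauchy_Schwarz.
Context d (T : measurableType d) (R : realType).
Variable mu : {finite_measure set T -> \bar R}.
Variables (w p : T -> R).
Hypotheses (mw : measurable_fun setT w) (w01 : forall x, 0 <= w x <= 1).
Hypotheses (mp : measurable_fun setT p).
Hypotheses (ip : mu.-integrable setT (EFin \o (fun x => p x ^+ 2))).

(** The integral of [w (p - t) ^ 2] is a polynomial in [t] of degree at most two that is nonnegative
    everywhere; its discriminant gives the bound. *)
Lemma weighted_Cauchy_Schwarz :
  (\int[mu]_x (w x * p x)) ^+ 2 <=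
  (\int[mu]_x w x) * \int[mu]_x (w x * p x ^+ 2).
Proof.
have w1 x : `|w x| <= 1 by have /andP[w0 w1] := w01 x; rewrite ger0_norm.
have iw : mu.-integrable setT (EFin \o w) by exact: (integrable_le_cst _ _ w1).
have ip1 := integrable_sq_integrable mp ip.
have iwp : mu.-integrable setT (EFin \o (fun x => w x * p x)).
  apply: (integrable_domin (g := fun x => `|p x|)).
  - exact: measurable_funM.
  - by move=> x; rewrite normrM ler_piMl.
  - exact: (integrable_norm ip1).
have iwp2 : mu.-integrable setT (EFin \o (fun x => w x * p x ^+ 2)).
  apply: (integrable_domin (g := fun x => p x ^+ 2)) => //.
  - by apply: measurable_funM => //; exact: measurable_funX.
  - by move=> x; rewrite normrM [X in _ * X]ger0_norm ?sqr_ge0// ler_piMl// sqr_ge0.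
apply: discriminant_le0.
  by apply: Rintegral_ge0 => x _; have /andP[] := w01 x.
move=> t; have : 0 <= \int[mu]_x (w x * (p x - t) ^+ 2).
  apply: Rintegral_ge0 => x _; rewrite mulr_ge0 ?sqr_ge0//.
  by have /andP[] := w01 x.
rewrite (_ : \int[mu]_x _ = \int[mu]_x
  (w x * p x ^+ 2 - 2 * t * (w x * p x) + t ^+ 2 * w x)); last first.
  by apply: eq_Rintegral => x _; ring.
rewrite RintegralD//; last 2 first.
- exact: (integrableB measurableT iwp2 (integrableZl measurableT (2 * t) iwp)).
- exact: (integrableZl _ _ iw).
rewrite RintegralB//; last exact: (integrableZl _ _ iwp).
by rewrite !RintegralZl.
Qed.

End weighted_Cauchy_Schwarz.

(** * Interval indicators and bounded directions in [L2] *)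

Section mu01_integrals.
Variable R : realType.
Notation mu := (@mu01 R).

Lemma mu01_itvco (a b : R) : 0 <= a -> a <= b -> b <= 1 ->
  mu `[a, b[%classic = (b - a)%:E.
Proof.
move=> a0 ab b1; rewrite /mu01 /mfrestr /mrestr /= setIidl; last first.
  move=> x /=; rewrite !in_itv/= => /andP[ax xb].
  by rewrite (le_trans a0 ax) (le_trans (ltW xb) b1).
by rewrite lebesgue_measure_itv/= lte_fin; case: ltgtP ab => //= -> _; rewrite subrr.
Qed.

Lemma Rintegral01_indic (a b : R) : 0 <= a -> a <= b -> b <= 1 ->
  \int[mu]_x \1_(`[a, b[%classic) x = b - a.
Proof.
move=> a0 ab b1; rewrite /Rintegral integral_indic// setIT.
rewrite [X in fine X](_ : _ = (b - a)%:E)//; exact: mu01_itvco.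
Qed.

Lemma integrable_indic01 (A : set R) : measurable A ->
  mu.-integrable setT (EFin \o (\1_A : R -> R)).
Proof.
move=> mA; apply: (@integrable_le_cst _ _ _ mu _ 1); first exact: measurable_indic.
by move=> x; rewrite indicE; case: (_ \in _); rewrite ?normr0 ?normr1.
Qed.

(** Makes step functions available as directions [p]: under a finite measure, a bounded measurable
    function is square-integrable. *)
Lemma bounded_L2 (f : R -> R) (C : R) : measurable_fun setT f ->
  (forall x, `|f x| <= C) -> exists p : L2 R, (p : R -> R) = f.
Proof.
move=> mf fC.
have fL : f \in Lfun mu 2%:E.
  rewrite inE; apply/andP; split; rewrite inE//=.
  rewrite /finite_norm unlock poweR_lty//.
  have mf2 : measurable_fun setT (fun x => `|f x| `^ 2).
    apply/(@measurableT_comp _ _ _ _ _ _ (fun x : R => x `^ 2)) => //.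
    exact: measurableT_comp.
  have C0 : 0 <= C by rewrite (le_trans _ (fC 0)).
  have : mu.-integrable setT (EFin \o (fun x => `|f x| `^ 2)).
    apply: (@integrable_le_cst _ _ _ mu _ (C ^+ 2)) => // x.
    by rewrite powR_mulrn// normrX normr_id lerXn2r ?nnegrE.
  move/integrableP => [_]; congr (_ < _)%E.
  by apply: eq_integral => x _; rewrite /= ger0_norm// powR_ge0.
by exists (Lfun_Sub (lee1n 2) fL).
Qed.

End mu01_integrals.

(** * The quadratic form on two-step functions *)

Section step_integrals.
Variables (R : realType) (m : R).
Hypothesis m01 : 0 <= m <= 1.
Notation mu := (@mu01 R).
Notation s := (step_sign m).

Lemma Rintegral_step_sign : \int[mu]_x s x = 2 * m - 1.
Proof.
have /andP[m0 m1] := m01.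
(* The equality is confined to [[0, 1]]: at negative [x] the left side is [1] and the right side
   [-1]. *)
have sE : {ae mu, forall x : measurableTypeR R, s x = 2 * \1_(`[0, m[%classic) x - 1}.
  apply: filterS (mu01_itv R) => x /= /andP[x0 x1].
  rewrite /step_sign indicE mem_setE in_itv/= x0/=.
  by case: ifP => _ /=; ring.
transitivity (\int[mu]_x (2 * \1_(`[0, m[%classic) x - 1)).
  apply: ae_eq_Rintegral.
  - exact: measurable_step_sign.
  - apply: measurable_funB => //; exact: measurable_funM.
  - exact: sE.
rewrite RintegralB//; last 2 first.
- exact: (integrableZl _ _ (integrable_indic01 _)).
- exact: finite_measure_integrable_cst.
rewrite RintegralZl//; last exact: integrable_indic01.
by rewrite Rintegral01_indic// Rintegral01_cst subr0.
Qed.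

(** Free constants [s1] and [s2] cover two adjacent intervals on the same side of [m] as well as one
    on each side. *)
Lemma hess_two_step (K Ks a b t1 t2 t3 s1 s2 : R) (p : R -> R) :
  0 <= t1 -> t1 <= t2 -> t2 <= t3 -> t3 <= 1 ->
  (forall x, t1 <= x < t2 -> s x = s1) -> (forall x, t2 <= x < t3 -> s x = s2) ->
  p = (fun x => a * \1_(`[t1, t2[%classic) x + b * \1_(`[t2, t3[%classic) x) ->
  hess mu s p K Ks =
  Ks * (a ^+ 2 * (t2 - t1) + b ^+ 2 * (t3 - t2)) +
  K / 2 * ((s1 * a * (t2 - t1) + s2 * b * (t3 - t2)) ^+ 2 -
    (2 * m - 1) * (s1 * a ^+ 2 * (t2 - t1) + s2 * b ^+ 2 * (t3 - t2))).
Proof.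
move=> t10 t12 t23 t31 sl sr pE.
have two u v : \int[mu]_x (u * \1_(`[t1, t2[%classic) x + v * \1_(`[t2, t3[%classic) x)
    = u * (t2 - t1) + v * (t3 - t2).
  rewrite RintegralD//; last 2 first.
  - exact: (integrableZl _ _ (integrable_indic01 _)).
  - exact: (integrableZl _ _ (integrable_indic01 _)).
  rewrite !RintegralZl//; try exact: integrable_indic01.
  rewrite !Rintegral01_indic//.
  - exact: le_trans t12.
  - exact: le_trans t31.
(* The two indicators are never both [1], so cross terms in [p ^ 2] vanish pointwise. *)
have E x : [\/ [/\ \1_(`[t1, t2[%classic) x = 1 :> R, \1_(`[t2, t3[%classic) x = 0 :> R & s x = s1],
     [/\ \1_(`[t1, t2[%classic) x = 0 :> R, \1_(`[t2, t3[%classic) x = 1 :> R & s x = s2] |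
     \1_(`[t1, t2[%classic) x = 0 :> R /\ \1_(`[t2, t3[%classic) x = 0 :> R].
  rewrite !indicE !mem_setE !in_itv/=.
  have [xt2|xt2] := ltP x t2.
    rewrite andbT /=; have [xt1|xt1] := leP t1 x; last by constructor 3.
    by constructor 1; split=> //; apply: sl; rewrite xt1 xt2.
  rewrite andbF /=; have [xt3|xt3] := ltP x t3; last by constructor 3.
  by constructor 2; split=> //; apply: sr; rewrite xt3 xt2.
rewrite /hess Rintegral_step_sign -(two (a ^+ 2)) -(two (s1 * a)) -(two (s1 * a ^+ 2)).
congr (_ * _ + _ * (_ ^+ 2 - _ * _)); apply: eq_Rintegral => x _; rewrite pE;
  by case: (E x) => [[-> -> sx]|[-> -> sx]|[-> ->]]; rewrite ?sx; ring.
Qed.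

End step_integrals.

(** * Bounds on the quadratic form and the resulting conditions *)

Lemma half_step_sign_itv (R : realType) (m x : R) :
  (0 <= (1 + step_sign m x) / 2 <= 1) /\ (0 <= (1 - step_sign m x) / 2 <= 1).
Proof. by rewrite /step_sign; case: ifP => _; lra. Qed.

Section hess_bounds.
Variables (R : realType) (m : R).
Hypothesis m01 : 0 <= m <= 1.
Notation mu := (@mu01 R).
Notation s := (step_sign m).

(* [P], [N] and [X], [Y] are the integrals of [p ^ 2] and [p] over [0, m[ and
   [m, 1]. *)
Lemma hess_split (K Ks : R) (p : L2 R) : exists P N X Y : R,
  [/\ \int[mu]_x (p x ^+ 2) = P + N /\ \int[mu]_x (s x * p x ^+ 2) = P - N,
      0 <= P /\ 0 <= N,
      X ^+ 2 <= m * P,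
      Y ^+ 2 <= (1 - m) * N &
      hess mu s p K Ks = Ks * (P + N) +
        K / 2 * ((X - Y) ^+ 2 - (2 * m - 1) * (P - N))].
Proof.
have ms : measurable_fun setT s by exact: measurable_step_sign.
have mp := measurable_L2 p.
have ip2 : mu.-integrable setT (EFin \o (fun x => p x ^+ 2)).
  exact: L2_sq_integrable.
have ip1 : mu.-integrable setT (EFin \o (p : R -> R)).
  exact: (@integrable_sq_integrable _ _ _ mu p mp ip2).
have isp1 : mu.-integrable setT (EFin \o (fun x => s x * p x)).
  apply: (integrable_domin (g := fun x => `|p x|)).
  - exact: measurable_funM.
  - by move=> x; rewrite normrM ler_piMl// normr_step_sign.
  - exact: (integrable_norm ip1).
have isp2 : mu.-integrable setT (EFin \o (fun x => s x * p x ^+ 2)).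
  apply: (integrable_domin (g := fun x => p x ^+ 2)) => //.
  - by apply: measurable_funM => //; exact: measurable_funX.
  - move=> x; rewrite normrM [X in _ * X]ger0_norm ?sqr_ge0//.
    by rewrite ler_piMl ?sqr_ge0// normr_step_sign.
have is1 : mu.-integrable setT (EFin \o s).
  by apply: (@integrable_le_cst _ _ _ mu _ 1) => // x; exact: normr_step_sign.
(* The weight [(1 + e * s x) / 2] is the indicator of one side of [m] for [e = 1] and of the other
   for [e = -1]; a free [e] treats both sides at once. *)
have wE (e : R) (f : R -> R) : mu.-integrable setT (EFin \o f) ->
    mu.-integrable setT (EFin \o (fun x => s x * f x)) ->
    \int[mu]_x ((1 + e * s x) / 2 * f x) =
    (\int[mu]_x f x + e * \int[mu]_x (s x * f x)) / 2.
  move=> if1 isf.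
  rewrite (_ : \int[mu]_x _ = \int[mu]_x (2^-1 * f x + e / 2 * (s x * f x))).
    rewrite RintegralD//; last 2 first.
    - exact: (integrableZl _ _ if1).
    - exact: (integrableZl _ _ isf).
    by rewrite !RintegralZl//; field.
  by apply: eq_Rintegral => x _; field.
have mw (e : R) : measurable_fun setT (fun x => (1 + e * s x) / 2).
  apply: measurable_funM => //; apply: measurable_funD => //.
  exact: measurable_funM.
(* The mass of each side: [m] for [e = 1], [1 - m] for [e = -1]. *)
have w1 (e : R) : \int[mu]_x ((1 + e * s x) / 2) = (1 + e * (2 * m - 1)) / 2.
  rewrite -(Rintegral_step_sign m01).
  have -> : \int[mu]_x ((1 + e * s x) / 2) = \int[mu]_x ((1 + e * s x) / 2 * 1).
    by apply: eq_Rintegral => x _; rewrite mulr1.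
  have s1E : (fun x => s x * 1) = s by apply/funext => x; rewrite mulr1.
  rewrite (wE e (fun=> 1)) ?s1E ?Rintegral01_cst//.
  exact: finite_measure_integrable_cst.
have wge0 (e : R) x : e ^+ 2 = 1 -> 0 <= (1 + e * s x) / 2 <= 1.
  move=> /eqP; rewrite sqrf_eq1 => /orP[] /eqP ->.
    by rewrite mul1r; exact: (half_step_sign_itv m x).1.
  by rewrite mulN1r; exact: (half_step_sign_itv m x).2.
have CS (e : R) : e ^+ 2 = 1 ->
    ((\int[mu]_x p x + e * \int[mu]_x (s x * p x)) / 2) ^+ 2 <=
    (1 + e * (2 * m - 1)) / 2 *
    ((\int[mu]_x (p x ^+ 2) + e * \int[mu]_x (s x * p x ^+ 2)) / 2).
  move=> e1; rewrite -w1 -wE// -wE//.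
  exact: (@weighted_Cauchy_Schwarz _ _ _ mu _ _ (mw e)
    (fun x => wge0 e x e1) mp ip2).
have ge0 (e : R) : e ^+ 2 = 1 ->
    0 <= (\int[mu]_x (p x ^+ 2) + e * \int[mu]_x (s x * p x ^+ 2)) / 2.
  move=> e1; rewrite -wE//; apply: Rintegral_ge0 => x _.
  by rewrite mulr_ge0 ?sqr_ge0//; have /andP[] := wge0 e x e1.
pose P e := (\int[mu]_x (p x ^+ 2) + e * \int[mu]_x (s x * p x ^+ 2)) / 2.
pose X e := (\int[mu]_x p x + e * \int[mu]_x (s x * p x)) / 2.
exists (P 1), (P (-1)), (X 1), (X (-1)); split.
- by rewrite /P; split; field.
- by split; apply: ge0; rewrite ?sqrrN expr1n.
- have := CS 1 (expr1n _ _); rewrite -/(P 1) -/(X 1).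
  by rewrite [X in _ <= X * _ -> _](_ : _ = m); last by field.
- have := CS (-1); rewrite sqrrN expr1n -/(P _) -/(X _) => /(_ erefl).
  by rewrite [X in _ <= X * _ -> _](_ : _ = 1 - m); last by field.
- rewrite /hess (Rintegral_step_sign m01) /P /X.
  by field.
Qed.

Variables (theta : Theta R) (K Ks : R).
Hypothesis Ks_gt0 : 0 < Ks.
Hypothesis theta_step : {ae mu, forall x, theta x = angle (step_angle m x)}.

Lemma directional_local_min_two_step (a b t1 t2 t3 s1 s2 : R) :
  directional_local_min (energy K Ks) theta ->
  0 <= t1 -> t1 <= t2 -> t2 <= t3 -> t3 <= 1 ->
  (forall x, t1 <= x < t2 -> s x = s1) -> (forall x, t2 <= x < t3 -> s x = s2) ->
  0 <= Ks * (a ^+ 2 * (t2 - t1) + b ^+ 2 * (t3 - t2)) +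
  K / 2 * ((s1 * a * (t2 - t1) + s2 * b * (t3 - t2)) ^+ 2 -
    (2 * m - 1) * (s1 * a ^+ 2 * (t2 - t1) + s2 * b ^+ 2 * (t3 - t2))).
Proof.
move=> dlm t10 t12 t23 t31 sl sr.
pose f (x : R) : R := a * \1_(`[t1, t2[%classic) x + b * \1_(`[t2, t3[%classic) x.
have [p pf] : exists p : L2 R, (p : R -> R) = f.
  apply: (@bounded_L2 R f (`|a| + `|b|)).
    by apply: measurable_funD; apply: measurable_funM.
  move=> x; rewrite (le_trans (ler_normD _ _))// lerD// normrM ler_piMr//.
    by rewrite indicE; case: (_ \in _); rewrite ?normr0 ?normr1.
  by rewrite indicE; case: (_ \in _); rewrite ?normr0 ?normr1.
have := directional_local_min_hess_ge0 theta_step p dlm.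
by rewrite (hess_two_step m01 K Ks t10 t12 t23 t31 sl sr pf).
Qed.

(** The test direction is [1] on the first half of [[0, m[] and [-1] on the second. Its mean is zero
    and [s] is constant there, so the square [(\int s p) ^ 2] vanishes. *)
Lemma directional_local_min_left : directional_local_min (energy K Ks) theta ->
  0 < m -> K * (2 * m - 1) <= 2 * Ks.
Proof.
move=> dlm m0; have /andP[_ m1] := m01.
have sl x : x < m -> s x = 1 by rewrite /step_sign => ->.
have [m20 m2m] : 0 <= m / 2 /\ m / 2 <= m by lra.
have := @directional_local_min_two_step 1 (-1) 0 (m / 2) m 1 1 dlm (lexx 0)
  m20 m2m m1.
have sl1 x : 0 <= x < m / 2 -> s x = 1 by move=> xm; apply: sl; lra.
have sl2 x : m / 2 <= x < m -> s x = 1 by move=> xm; apply: sl; lra.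
move=> /(_ sl1 sl2).
rewrite (_ : _ + _ = m / 2 * (2 * Ks - K * (2 * m - 1))); last by field.
by rewrite pmulr_rge0 ?subr_ge0// divr_gt0.
Qed.

(** The same zero-mean test on the two halves of [[m, 1[], where [s = -1] reverses the sign of the
    [K] term. *)
Lemma directional_local_min_right : directional_local_min (energy K Ks) theta ->
  m < 1 -> - (K * (2 * m - 1)) <= 2 * Ks.
Proof.
move=> dlm m1; have /andP[m0 _] := m01.
have sr x : m <= x -> s x = -1 by rewrite /step_sign leNgt => /negbTE ->.
have [mm2 m21] : m <= (m + 1) / 2 /\ (m + 1) / 2 <= 1 by lra.
have := @directional_local_min_two_step 1 (-1) m ((m + 1) / 2) 1 (-1) (-1) dlm
  m0 mm2 m21 (lexx 1).
have sr1 x : m <= x < (m + 1) / 2 -> s x = -1 by move=> xm; apply: sr; lra.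
have sr2 x : (m + 1) / 2 <= x < 1 -> s x = -1 by move=> xm; apply: sr; lra.
move=> /(_ sr1 sr2).
rewrite (_ : _ + _ = (1 - m) / 2 * (2 * Ks + K * (2 * m - 1))); last by field.
by rewrite pmulr_rge0 ?divr_gt0 ?subr_gt0//; lra.
Qed.

(* The weights [1 - m] and [- m] span the kernel of the quadratic form at the
   threshold [K = - 2 Ks]. *)
Lemma directional_local_min_both : directional_local_min (energy K Ks) theta ->
  0 < m < 1 -> - 2 * Ks <= K.
Proof.
move=> dlm /andP[m0 m1].
have sl x : 0 <= x < m -> s x = 1 by rewrite /step_sign => /andP[_ ->].
have sr x : m <= x < 1 -> s x = -1.
  by rewrite /step_sign leNgt => /andP[/negbTE ->].
have := @directional_local_min_two_step (1 - m) (- m) 0 m 1 1 (-1) dlm (lexx 0)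
  (ltW m0) (ltW m1) (lexx 1) sl sr.
(* After [m (1 - m)] is factored out, the identity [4 m (1 - m) + (2 m - 1) ^ 2 = 1] collapses the
   coefficient of [K / 2]. *)
rewrite (_ : _ + _ = (m * (1 - m)) / 2 * (2 * Ks + K)); last by field.
by rewrite pmulr_rge0; [lra|rewrite divr_gt0// mulr_gt0// subr_gt0].
Qed.

Lemma directional_local_min_interior :
  - 2 * Ks < K -> `|K * (2 * m - 1)| < 2 * Ks ->
  directional_local_min (energy K Ks) theta.
Proof.
move=> Kl; rewrite ltr_norml => /andP[Kr1 Kr2].
apply: (hess_gt0_directional_local_min theta_step) => p.
have [P [N [X [Y [[-> _] [P0 N0] XP YN ->]]]]] := hess_split K Ks p => PN0.
have PN : 0 < P + N by rewrite lt_neqAle eq_sym PN0 addr_ge0.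
have [K0|K0] := leP 0 K.
  (* For [K >= 0] the square is dropped; [P] and [N] keep the coefficients [Ks - K (2 m - 1) / 2]
     and [Ks + K (2 m - 1) / 2], both positive, and one of [P], [N] is positive. *)
  have := mulr_ge0 K0 (sqr_ge0 (X - Y)).
  have [P1|P1] := leP P 0.
    have N1 : 0 < N by lra.
    have -> : P = 0 by apply/eqP; rewrite eq_le P1.
    nra.
  nra.
(* Subtracting [(2 m - 1) (P - N)] from this bound leaves exactly [P + N]. *)
have : (X - Y) ^+ 2 <= 2 * (m * P + (1 - m) * N).
  by have := sqr_ge0 (X + Y); nra.
move=> XY.
have : K * (2 * (m * P + (1 - m) * N)) <= K * (X - Y) ^+ 2.
  by rewrite ler_nM2l.
have : 0 < (2 * Ks + K) * (P + N) by rewrite mulr_gt0//; lra.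
lra.
Qed.

(** One side of [m] is null; for [m = 1] the null point [x = 1], where [s] is [-1], is discarded. *)
Lemma step_sign_endpoint : m = 0 \/ m = 1 ->
  {ae mu, forall x : measurableTypeR R, s x = 2 * m - 1}.
Proof.
move=> m_end; apply: filterS2 (mu01_itv R) (mu01_neq m) => x /= /andP[x0 x1] xm.
rewrite /step_sign; case: m_end xm => -> xm.
  by rewrite ltNge x0 /=; lra.
by rewrite lt_neqAle xm x1 /=; lra.
Qed.

(** As [s] is a.e. constant, one of [P], [N] is zero and the form reads [Ks z + K / 2 (x ^ 2 - z)]
    in the other pair. Cauchy-Schwarz gives [x ^ 2 <= z], so a negative [K] only adds a nonnegative
    term. *)
Lemma directional_local_min_endpoint : m = 0 \/ m = 1 -> K < 2 * Ks ->
  directional_local_min (energy K Ks) theta.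
Proof.
move=> m_end Kr.
apply: (hess_gt0_directional_local_min theta_step) => p.
have [P [N [X [Y [[Ap sp2] [P0 N0] XP YN ->]]]]] := hess_split K Ks p.
rewrite Ap => PN0; have {}PN0 : 0 < P + N by rewrite lt_neqAle eq_sym PN0 addr_ge0.
have pos x z : 0 < z -> x ^+ 2 <= z -> 0 < Ks * z + K / 2 * (x ^+ 2 - z).
  move=> z0 xz; have [K0|K0] := leP 0 K.
    have := mulr_ge0 K0 (sqr_ge0 x).
    have : 0 < (2 * Ks - K) * z by rewrite mulr_gt0// subr_gt0.
    lra.
  have : K * z <= K * x ^+ 2 by rewrite ler_nM2l.
  have : 0 < Ks * z by rewrite mulr_gt0.
  lra.
(* At [m = 0] this identity forces [P = 0], at [m = 1] it forces [N = 0]. *)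
have {sp2} : P - N = (2 * m - 1) * (P + N).
  rewrite -sp2 -Ap -RintegralZl//; last exact: L2_sq_integrable.
  have mp2 := measurable_funX 2 (measurable_L2 p).
  apply: ae_eq_Rintegral.
  - by apply: measurable_funM => //; exact: measurable_step_sign.
  - exact: measurable_funM.
  - by apply: filterS (step_sign_endpoint m_end) => x /= ->.
case: m_end XP YN => ->.
  rewrite mul0r subr0 mul1r => X0 YN PN.
  have P00 : P = 0 by lra.
  have /eqP : X ^+ 2 = 0 by apply/eqP; rewrite eq_le X0 sqr_ge0.
  rewrite sqrf_eq0 => /eqP ->.
  have := pos Y N; rewrite P00; lra.
rewrite mul1r subrr mul0r => XP Y0 PN.
have N00 : N = 0 by lra.
have /eqP : Y ^+ 2 = 0 by apply/eqP; rewrite eq_le Y0 sqr_ge0.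
rewrite sqrf_eq0 => /eqP ->.
have := pos X P; rewrite N00; lra.
Qed.

End hess_bounds.

(** * The step configuration almost everywhere, and the three cases for [m] *)

Lemma ae_step_angle (R : realType) (m : R) (theta : Theta R) :
  {ae @mu01 R, forall x, 0 <= x < m -> theta x = 0} ->
  {ae @mu01 R, forall x, m < x <= 1 -> theta x = angle pi} ->
  {ae @mu01 R, forall x, theta x = angle (step_angle m x)}.
Proof.
move=> theta0 thetapi.
(* The points not covered by the two hypotheses, [m] and those outside [[0, 1]], form a null set. *)
have range : {ae @mu01 R, forall x : measurableTypeR R, 0 <= x <= 1 /\ x != m}.
  by apply: filterS2 (mu01_itv R) (mu01_neq m).
apply: filterS3 range theta0 thetapi => x /= [/andP[x0 x1] xm] theta0 thetapi.
rewrite /step_angle; case: ltP => mx; last by rewrite thetapi// lt_neqAle eq_sym xm mx.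
(* [angle 0 = 0] follows from additivity by cancelling [angle 0]. *)
by rewrite theta0 ?x0//; apply: (addrI (angle 0)); rewrite -angleD !addr0.
Qed.

Theorem theorem5p3 (R : realType) (K Ks m : R) (theta : Theta R)
    (Ks_gt0 : 0 < Ks) (m01 : 0 <= m <= 1)
    (theta0 : {ae @mu01 R, forall x, 0 <= x < m -> theta x = 0})
    (thetapi : {ae @mu01 R, forall x, m < x <= 1 -> theta x = angle pi}) :
  [/\ m = 0 \/ m = 1 ->
        (directional_local_min (energy K Ks) theta -> K / Ks <= 2) /\
        (K / Ks < 2 -> directional_local_min (energy K Ks) theta),
      m = 1 / 2 ->
        (directional_local_min (energy K Ks) theta -> -2 <= K / Ks) /\
        (-2 < K / Ks -> directional_local_min (energy K Ks) theta)
    & m <> 0 /\ m <> 1 / 2 /\ m <> 1 ->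
        (directional_local_min (energy K Ks) theta ->
          -2 <= K / Ks <= 2 / `|2 * m - 1|) /\
        (-2 < K / Ks < 2 / `|2 * m - 1| ->
          directional_local_min (energy K Ks) theta)].
Proof.
have theta_step := ae_step_angle theta0 thetapi.
have interior := directional_local_min_interior m01 theta_step.
split.
- move=> m_end; rewrite ler_pdivrMr// ltr_pdivrMr//; split => [dlm|]; last first.
    exact: (directional_local_min_endpoint m01 Ks_gt0 theta_step m_end).
  (* Only the side of positive length carries a test direction: the right one at [m = 0], the left
     one at [m = 1]. *)
  case: m_end => mE.
    have := directional_local_min_right m01 theta_step dlm.
    by rewrite mE => /(_ ltr01); lra.
  have := directional_local_min_left m01 theta_step dlm.
  by rewrite mE => /(_ ltr01); lra.
- move=> mE; rewrite ler_pdivlMr// ltr_pdivlMr//; split => [dlm|Kl].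
    apply: (directional_local_min_both m01 theta_step dlm).
    by rewrite mE; lra.
  (* The integral of [s] is zero here, so the bound on [|K (2 m - 1)|] reduces to [0 < 2 Ks]. *)
  apply: interior => //; rewrite (_ : 2 * m - 1 = 0) ?mulr0 ?normr0 ?mulr_gt0//.
  by rewrite mE; lra.
- move=> [/eqP mn0 [/eqP mn2 /eqP mn1]]; have /andP[m0 m1] := m01.
  have {}m0 : 0 < m by rewrite lt_neqAle eq_sym mn0.
  have {}m1 : m < 1 by rewrite lt_neqAle mn1.
  have M0 : 0 < `|2 * m - 1|.
    by rewrite normr_gt0; apply: contra mn2 => /eqP M0; apply/eqP; lra.
  rewrite ler_pdivlMr// ltr_pdivlMr// ler_pdivlMr// ltr_pdivlMr//.
  rewrite ![K / Ks * _]mulrAC ler_pdivrMr// ltr_pdivrMr//.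
  split => [dlm|/andP[Kl Kr]].
    have -> /= : - 2 * Ks <= K.
      by apply: (directional_local_min_both m01 theta_step dlm); rewrite m0.
    (* The two one-sided tests bound [K (2 m - 1)] and its opposite; the sign of [2 m - 1] selects
       the one equal to [K |2 m - 1|]. *)
    have := directional_local_min_left m01 theta_step dlm m0.
    have := directional_local_min_right m01 theta_step dlm m1.
    by case: (ger0P (2 * m - 1)) => _; rewrite ?mulrN.
  apply: interior => //; rewrite normrM; have [K0|K0] := leP 0 K.
    by rewrite (ger0_norm K0).
  (* For [K < 0] the lower bound on [K] suffices: [|2 m - 1| <= 1] and [- K < 2 Ks]. *)
  rewrite (ltr0_norm K0) (@le_lt_trans _ _ (- K * 1))//; last by lra.
  by rewrite ler_pM2l ?oppr_gt0// ler_norml; lra.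
Qed.
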